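(* Let $(A,[\cdot,\cdot])$ be a left-Alia algebra. Then there is a compatible pre-left-Alia algebra $(A,\succ,\prec)$ of $(A,[\cdot,\cdot])$ if and only if there exists an invertible relative Rota-Baxter operator $T:V\to A$ of $(A,[\cdot,\cdot])$ with respect to some representation $(l,r,V)$ of $(A,[\cdot,\cdot])$. Furthermore, (given such a $T$) the compatible pre-left-Alia algebra is given by $$x\succ y=T\big(l(x)T^{-1}y\big),\qquad x\prec y=T\big(r(y)T^{-1}x\big),\qquad\forall x,y\in A.$$
   Context: All vector spaces are finite-dimensional over an algebraically closed field $\mathbb K$ of characteristic zero. A left-Alia algebra is a vector space $A$ with a bilinear map $[\cdot,\cdot]:A\times A\to A$ (not assumed antisymmetric) such that for all $x,y,z\in A$ $$[[x,y],z]+[[y,z],x]+[[z,x],y]=[[y,x],z]+[[z,y],x]+[[x,z],y].$$ A representation of $(A,[\cdot,\cdot])$ is a triple $(l,r,V)$ with $V$ a vector space and $l,r:A\to\mathrm{End}(V)$ linear maps such that for all $x,y\in A$ $$l([x,y])-l([y,x])=r(x)r(y)-r(y)r(x)+r(y)l(x)-r(x)l(y).$$ A linear map $T:V\to A$ is a relative Rota-Baxter operator of $(A,[\cdot,\cdot])$ with respect to (associated to) $(l,r,V)$ if $[T(u),T(v)]=T\big(l(Tu)v+r(Tv)u\big)$ for all $u,v\in V$. A pre-left-Alia algebra is a triple $(A,\succ,\prec)$ where $A$ is a vector space and $\succ,\prec:A\otimes A\to A$ are bilinear multiplications such that for all $x,y,z\in A$ $$(x\succ y+x\prec y)\succ z-(y\succ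 x+y\prec x)\succ z+(y\succ z-z\prec y)\prec x+(z\prec x-x\succ z)\prec y=0.$$ A pre-left-Alia algebra $(A,\succ,\prec)$ is a compatible pre-left-Alia algebra of a left-Alia algebra $(A,[\cdot,\cdot])$ if $[x,y]=x\succ y+x\prec y$ for all $x,y\in A$. *)

(* Defs.v *)
From HB Require Import structures.
From mathcomp Require Import all_boot all_order all_algebra.

Set Implicit Arguments.
Unset Strict Implicit.
Unset Printing Implicit Defensive.

Import GRing.Theory.

Local Open Scope ring_scope.

Definition left_alia (K : fieldType) (A : vectType K)
    (br : {bilinear A -> A -> A}) : Prop :=
  forall x y z : A,
    br (br x y) z + br (br y z) x + br (br z x) y
    = br (br y x) z + br (br z y) x + br (br x z) y.

Definition left_alia_rep (K : fieldType) (A : vectType K)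
    (br : {bilinear A -> A -> A}) (V : vectType K)
    (l r : 'Hom(A, 'End(V))) : Prop :=
  forall x y : A,
    l (br x y) - l (br y x)
    = (r x \o r y)%VF - (r y \o r x)%VF + (r y \o l x)%VF - (r x \o l y)%VF.

Definition relative_Rota_Baxter (K : fieldType) (A : vectType K)
    (br : {bilinear A -> A -> A}) (V : vectType K)
    (l r : 'Hom(A, 'End(V))) (T : 'Hom(V, A)) : Prop :=
  forall u v : V, br (T u) (T v) = T (l (T u) v + r (T v) u).

Definition pre_left_alia (K : fieldType) (A : vectType K)
    (succ prec : {bilinear A -> A -> A}) : Prop :=
  forall x y z : A,
    succ (succ x y + prec x y) z - succ (succ y x + prec y x) z
    + prec (succ y z - prec z y) x + prec (prec z x - succ x z) y = 0.

Definition compatible_pre_left_alia (K : fieldType) (A : vectType K)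
    (br succ prec : {bilinear A -> A -> A}) : Prop :=
  pre_left_alia succ prec /\ forall x y : A, br x y = succ x y + prec x y.

(* Main.v *)
Require Import Defs.
From HB Require Import structures.
From mathcomp Require Import all_boot all_order all_algebra.

(** Every pre-left-Alia structure inducing the bracket [br] amounts to a pair of
    maps [l x = x ≻ _] and [r y = _ ≺ y] (with [≻] for [succ] and [≺] for
    [prec]), possibly read through a linear
    isomorphism [T : V -> A] as [x ≻ T v = T (l x v)] and [T v ≺ y = T (r y v)].
    Under this dictionary the two axioms in play are the same equation.  Put
    [z = T v] in the pre-left-Alia identity: [x ≻ y + x ≺ y] is [br x y], and
    every product in it is then an operator [l] or [r] acting on [v], so that
    its left-hand side is [T] of the defect of the representation identity at
    [x], [y], evaluated at [v].  As [T] is bijective, one vanishes identically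
    iff the other does; this is [pre_left_alia_repE].

    The remaining condition, [br x y = x ≻ y + x ≺ y], is the Rota-Baxter
    identity for [T] at [u = T^-1 x], [v = T^-1 y].  So an invertible relative
    Rota-Baxter operator gives a compatible structure by transport along [T],
    and conversely a compatible structure makes the identity of [A] an
    invertible relative Rota-Baxter operator for the representation on [A]
    itself by left [≻]- and right [≺]-multiplications. *)

Set Implicit Arguments.
Unset Strict Implicit.
Unset Printing Implicit Defensive.

Import GRing.Theory.

Local Open Scope ring_scope.

Lemma bilinear_ofP (K : fieldType) (U V W : vectType K) (f : U -> V -> W) :
    (forall v, linear (f^~ v)) -> (forall u, linear (f u)) ->
  exists b : {bilinear U -> V -> W}, forall u v, b u v = f u v.
Proof.
move=> fl fr.
pose fB := bilinear_isBilinear.Build K U V W *:%R *:%R f (fl, fr).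
pose b : {bilinear U -> V -> W} := HB.pack f fB.
by exists b.
Qed.

Lemma bilinear_curryP (K : fieldType) (U V W : vectType K)
    (b : {bilinear U -> V -> W}) :
  exists g : 'Hom(U, 'Hom(V, W)), forall u v, g u v = b u v.
Proof.
pose f u : 'Hom(V, W) := linfun (b u).
have f_lin : linear f.
  move=> a u1 u2; apply/lfunP => v.
  by rewrite add_lfunE scale_lfunE !lfunE /= linearPl.
pose fM := GRing.isLinear.Build K U 'Hom(V, W) *:%R f f_lin.
pose fL : {linear U -> 'Hom(V, W)} := HB.pack f fM.
by exists (linfun fL) => u v; rewrite lfunE /= lfunE.
Qed.

Lemma bilinear_flip_curryP (K : fieldType) (U V W : vectType K)
    (b : {bilinear U -> V -> W}) :
  exists g : 'Hom(V, 'Hom(U, W)), forall v u, g v u = b u v.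
Proof.
have [u a v1 v2|v a u1 u2|c cE] := @bilinear_ofP _ V U W (fun v u => b u v).
- exact: linearPr.
- exact: linearPl.
by have [g gE] := bilinear_curryP c; exists g => v u; rewrite gE cE.
Qed.

Lemma bijective_lfunVK (K : fieldType) (V A : vectType K) (T : 'Hom(V, A)) :
  bijective T -> cancel T (T^-1%VF) /\ cancel (T^-1%VF) T.
Proof.
case=> g TK gK; have T'K : cancel T (T^-1%VF).
  by apply/lker0_lfunK/lker0P/(can_inj TK).
by split=> // x; rewrite -(gK x) T'K.
Qed.

(** Surjectivity of [T] lets [T v] range over all third arguments of the
    pre-left-Alia identity, injectivity cancels the outer [T].  Stating the
    dictionary through equations on [T v], without [T^-1], lets the same lemma
    serve for a general [T] and for the identity of [A]. *)
Lemma pre_left_alia_repE (K : fieldType) (A V : vectType K)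
    (br succ prec : {bilinear A -> A -> A})
    (l r : 'Hom(A, 'End(V))) (T : 'Hom(V, A)) :
    bijective T ->
    (forall x y, br x y = succ x y + prec x y) ->
    (forall x v, succ x (T v) = T (l x v)) ->
    (forall y v, prec (T v) y = T (r y v)) ->
  pre_left_alia succ prec <-> left_alia_rep br l r.
Proof.
case=> T' TK T'K brE succT precT.
have defectE x y v :
    succ (succ x y + prec x y) (T v) - succ (succ y x + prec y x) (T v)
      + prec (succ y (T v) - prec (T v) y) x
      + prec (prec (T v) x - succ x (T v)) y
    = T ((l (br x y) - l (br y x)
      - ((r x \o r y)%VF - (r y \o r x)%VF
         + (r y \o l x)%VF - (r x \o l y)%VF)) v).
  rewrite -!brE !succT !precT -!linearB !precT -!linearD /=.
  congr (T _); rewrite !(add_lfunE, opp_lfunE, comp_lfunE) !linearB /=.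
  rewrite [X in _ = X + _]add_lfunE opp_lfunE !opprD !opprK -!addrA.
  do 2!congr (_ + _).
  by rewrite addrC -!addrA.
split=> [preP x y|repP x y z].
  apply/eqP; rewrite -subr_eq0; apply/eqP/lfunP => v; rewrite zero_lfunE.
  by apply: (can_inj TK); rewrite -defectE preP linear0.
by rewrite -(T'K z) defectE repP subrr zero_lfunE linear0.
Qed.

Lemma Rota_Baxter_compatible (K : fieldType) (A V : vectType K)
    (br : {bilinear A -> A -> A}) (l r : 'Hom(A, 'End(V))) (T : 'Hom(V, A)) :
    left_alia_rep br l r -> relative_Rota_Baxter br l r T -> bijective T ->
  exists succ prec : {bilinear A -> A -> A},
    [/\ forall x y : A, succ x y = T (l x (T^-1%VF y)),
        forall x y : A, prec x y = T (r y (T^-1%VF x))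
      & compatible_pre_left_alia br succ prec].
Proof.
move=> repP rbP Tbij; have [TK T'K] := bijective_lfunVK Tbij.
have [y a x1 x2|x a y1 y2|succ succE] :=
    @bilinear_ofP _ A A A (fun x y => T (l x (T^-1%VF y))).
- by rewrite linearP add_lfunE scale_lfunE linearP.
- by rewrite !linearP.
have [y a x1 x2|x a y1 y2|prec precE] :=
    @bilinear_ofP _ A A A (fun x y => T (r y (T^-1%VF x))).
- by rewrite !linearP.
- by rewrite linearP add_lfunE scale_lfunE linearP.
(* The Rota-Baxter identity at [T^-1 x], [T^-1 y]. *)
have brE x y : br x y = succ x y + prec x y.
  by rewrite succE precE -linearD -{1}(T'K x) -{1}(T'K y) rbP !T'K.
exists succ, prec; split=> //; split=> //.
by apply/(pre_left_alia_repE Tbij brE _ _) => // x v;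
  rewrite ?succE ?precE TK.
Qed.

(** The witnesses are [l x = succ x _] and [r y = prec _ y]; the Rota-Baxter
    identity for the identity map is then compatibility itself. *)
Lemma compatible_id_Rota_Baxter (K : fieldType) (A : vectType K)
    (br succ prec : {bilinear A -> A -> A}) :
    compatible_pre_left_alia br succ prec ->
  exists l r : 'Hom(A, 'End(A)),
    left_alia_rep br l r /\ relative_Rota_Baxter br l r \1%VF.
Proof.
move=> [preP brE].
have [l lE] := bilinear_curryP succ; have [r rE] := bilinear_flip_curryP prec.
exists l, r; split=> [|u v]; last by rewrite !id_lfunE brE lE rE.
have id_bij : bijective (\1%VF : 'End(A)).
  by exists id => x; rewrite id_lfunE.
by apply/(pre_left_alia_repE id_bij brE _ _) => // x v;
  rewrite !id_lfunE ?lE ?rE.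
Qed.

(* [T^-1%VF] is a total operation on ['Hom(V, A)]; it is the two-sided inverse
   of [T] as soon as [T] is bijective. *)
Theorem theorem6p6 (K : closedFieldType) (charK0 : [pchar K] =i pred0)
    (A : vectType K) (br : {bilinear A -> A -> A}) (brP : left_alia br) :
  ((exists succ prec : {bilinear A -> A -> A},
       compatible_pre_left_alia br succ prec)
   <->
   (exists (V : vectType K) (l r : 'Hom(A, 'End(V))) (T : 'Hom(V, A)),
       [/\ left_alia_rep br l r, relative_Rota_Baxter br l r T
         & bijective T]))
  /\
  (forall (V : vectType K) (l r : 'Hom(A, 'End(V))) (T : 'Hom(V, A)),
     left_alia_rep br l r -> relative_Rota_Baxter br l r T -> bijective T ->
     exists succ prec : {bilinear A -> A -> A},
       [/\ forall x y : A, succ x y = T (l x (T^-1%VF y)),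
           forall x y : A, prec x y = T (r y (T^-1%VF x))
         & compatible_pre_left_alia br succ prec]).
Proof.
split; last by move=> V l r T; apply: Rota_Baxter_compatible.
split=> [[succ [prec /compatible_id_Rota_Baxter [l [r [repP rbP]]]]]|].
  exists A, l, r, \1%VF; split=> //.
  by exists id => x; rewrite id_lfunE.
move=> [V [l [r [T [repP rbP Tbij]]]]].
have [succ [prec [_ _ compP]]] := Rota_Baxter_compatible repP rbP Tbij.
by exists succ, prec.
Qed.
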